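(* Let $\widetilde A\in\mathbb{R}^{m\times n}$, $\widetilde A\ne 0$, $\widetilde b\in\mathbb{R}^m$ and $x_0\in\mathbb{R}^n$ be given. The minimum radius among all balls $B(x_{\rm LS},r_{A,b})$ generated by all pairs $(A,b)\in\mathcal{K}(x_0)$ is $$\min\{\, r_{A,b} : Ax=b \text{ is consistent, and } x_0-x_{\rm LS}\in\mathrm{range}(\widetilde A^\top)\,\}=\frac{\|\widetilde A\widetilde x_{\rm LS}-\widetilde b\|}{\widetilde\sigma_{\min}},$$ where $\widetilde x_{\rm LS}=\widetilde A^\dagger\widetilde b$. Moreover, the center of any ball attaining the minimum radius depends on $x_0$ and is given uniquely by $$x_{\rm LS}=\widetilde x_{\rm LS}+x_0^n.$$
   Context: For $(A,b)\in\mathbb{R}^{m\times n}\times\mathbb{R}^m$ put $x_{\rm LS}=A^\dagger b$ (Moore–Penrose pseudoinverse), $E=\widetilde A-A$, $\epsilon=\widetilde b-b$, and $$r_{A,b}=\frac{\|Ex_{\rm LS}-\epsilon\|}{\widetilde\sigma_{\min}},$$ where $\widetilde\sigma_{\min}$ is the smallest nonzero singular value of $\widetilde A$ and $\|\cdot\|$ is the Euclidean norm. $B(c,\rho)$ denotes the ball in $\mathbb{R}^n$ with center $c$ and radius $\rho$. $\mathcal{K}(x_0)$ is the set of all pairs $(A,b)\in\mathbb{R}^{m\times n}\times\mathbb{R}^m$ such that the system $Ax=b$ is consistent and $x_0-x_{\rm LS}\in\mathrm{range}(\widetilde A^\top)$. For $v\in\mathbb{R}^n$, $v^n$ denotes the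 orthogonal projection of $v$ onto $\mathrm{null}(\widetilde A)$. *)

(* Defs.v *)
From HB Require Import structures.
From mathcomp Require Import all_boot all_order all_algebra.
From mathcomp Require Import boolp classical_sets reals.
From mathcomp Require complex.

Set Implicit Arguments.
Unset Strict Implicit.
Unset Printing Implicit Defensive.

Import Order.TTheory GRing.Theory Num.Theory.

Local Open Scope classical_set_scope.
Local Open Scope ring_scope.

(* The norm that MathComp-Analysis puts on matrices is the sup norm, hence this
   definition. *)
Definition enorm (R : realType) (n : nat) (v : 'cV[R]_n) : R :=
  Num.sqrt (\sum_(i < n) v i 0 ^+ 2).

Definition is_min (R : realType) (S : set R) (x : R) : Prop :=
  S x /\ lbound S x.

Definition mxrange (R : realType) (m n : nat) (A : 'M[R]_(m, n)) : set 'cV[R]_m :=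
  [set A *m x | x in [set: 'cV[R]_n]].

Definition mxnull (R : realType) (m n : nat) (A : 'M[R]_(m, n)) : set 'cV[R]_n :=
  [set x | A *m x = 0].

(* The four Penrose equations.  MathComp's [pinvmx] is only a partial inverse:
   in general it satisfies neither of the two symmetry conditions. *)
Definition penrose (R : realType) (m n : nat)
    (A : 'M[R]_(m, n)) (X : 'M[R]_(n, m)) : Prop :=
  [/\ A *m X *m A = A, X *m A *m X = X,
      (A *m X)^T = A *m X & (X *m A)^T = X *m A].

(* [penrose A] has exactly one solution ([penrose_mpinv], [penrose_uniq]). *)
Definition mpinv (R : realType) (m n : nat) (A : 'M[R]_(m, n)) : 'M[R]_(n, m) :=
  xget 0 [set X | penrose A X].

Definition is_orthproj (R : realType) (n : nat) (S : set 'cV[R]_n)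
    (v p : 'cV[R]_n) : Prop :=
  S p /\ forall z, S z -> (v - p)^T *m z = 0.

(* Well defined when S is the null space of a matrix ([orthproj_nullP],
   [is_orthproj_null_uniq]). *)
Definition orthproj (R : realType) (n : nat) (S : set 'cV[R]_n)
    (v : 'cV[R]_n) : 'cV[R]_n :=
  xget 0 [set p | is_orthproj S v p].

Definition singular_value (R : realType) (m n : nat) (A : 'M[R]_(m, n)) (s : R)
    : Prop :=
  0 <= s /\ eigenvalue (A^T *m A) (s ^+ 2).

(* The minimum exists as soon as A != 0 ([sigma_minP]). *)
Definition sigma_min (R : realType) (m n : nat) (A : 'M[R]_(m, n)) : R :=
  xget 0 [set s | is_min [set t | singular_value A t /\ t != 0] s].

Definition xLS (R : realType) (m n : nat) (A : 'M[R]_(m, n)) (b : 'cV[R]_m)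
    : 'cV[R]_n :=
  mpinv A *m b.

Definition consistent (R : realType) (m n : nat) (A : 'M[R]_(m, n))
    (b : 'cV[R]_m) : Prop :=
  exists x : 'cV[R]_n, A *m x = b.

(* (A', b') is the given perturbed pair (written with tildes on paper) and
   (A, b) the unperturbed one. *)
Definition radius (R : realType) (m n : nat) (A' : 'M[R]_(m, n)) (b' : 'cV[R]_m)
    (A : 'M[R]_(m, n)) (b : 'cV[R]_m) : R :=
  let E := A' - A in
  let eps := b' - b in
  enorm (E *m xLS A b - eps) / sigma_min A'.

Definition Kset (R : realType) (m n : nat) (A' : 'M[R]_(m, n)) (x0 : 'cV[R]_n)
    : set ('M[R]_(m, n) * 'cV[R]_m) :=
  [set Ab | consistent Ab.1 Ab.2 /\ mxrange A'^T (x0 - xLS Ab.1 Ab.2)].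

Section Facts.
Variable R : realType.

Lemma mulTmx_eq0 m n (A : 'M[R]_(m, n)) : A^T *m A = 0 -> A = 0.
Proof.
move=> AA0; apply/matrixP => i j; rewrite mxE.
have /matrixP/(_ j j) := AA0; rewrite !mxE => /eqP.
rewrite psumr_eq0; last by move=> k _; rewrite mxE -expr2 sqr_ge0.
move=> /allP /(_ i (mem_index_enum _)) /=.
by rewrite mxE mulf_eq0 orbb => /eqP.
Qed.

Lemma gram_unit m r (C : 'M[R]_(m, r)) : row_full C -> C^T *m C \in unitmx.
Proof.
move=> Cfull; rewrite -row_free_unit; apply/row_freeP.
suff k0 : kermx (C^T *m C) = 0.
  by apply/row_freeP; rewrite -kermx_eq0 k0.
set K := kermx _.
have KC : K *m C^T = 0.
  have : (K *m C^T) *m (K *m C^T)^T = 0.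
    by rewrite trmx_mul trmxK mulmxA -(mulmxA K) mulmx_ker mul0mx.
  move=> h; apply: trmx_inj; rewrite trmx0; apply: mulTmx_eq0.
  by rewrite trmxK.
have CTfree : row_free C^T by rewrite /row_free mxrank_tr.
by apply: (row_free_inj CTfree); rewrite mul0mx.
Qed.

Lemma penrose_ex m n (A : 'M[R]_(m, n)) : exists X, penrose A X.
Proof.
have uC : (col_base A)^T *m col_base A \in unitmx.
  exact/gram_unit/col_base_full.
have uF : row_base A *m (row_base A)^T \in unitmx.
  rewrite -{1}(trmxK (row_base A)); apply: gram_unit.
  by rewrite /row_full mxrank_tr; apply: row_base_free.
have := esym (mulmx_base A).
move: (col_base A) (row_base A) uC uF; move: (\rank A) => r C F uC uF AE.
set U := invmx (C^T *m C); set V := invmx (F *m F^T).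
have UT : U^T = U by rewrite /U trmx_inv trmx_mul trmxK.
have VT : V^T = V by rewrite /V trmx_inv trmx_mul trmxK.
have FV : F *m (F^T *m V) = 1%:M by rewrite mulmxA mulmxV.
have UC : U *m C^T *m C = 1%:M by rewrite -mulmxA mulVmx.
exists (F^T *m V *m (U *m C^T)).
have AX : A *m (F^T *m V *m (U *m C^T)) = C *m (U *m C^T).
  by rewrite AE -(mulmxA C) (mulmxA F) FV mul1mx.
have XA : F^T *m V *m (U *m C^T) *m A = F^T *m V *m F.
  by rewrite AE -(mulmxA (F^T *m V)) (mulmxA _ C) UC mul1mx.
split.
- by rewrite AX AE -(mulmxA C) (mulmxA _ C) UC mul1mx.
- by rewrite XA -(mulmxA (F^T *m V)) (mulmxA F) FV mul1mx.
- by rewrite AX !trmx_mul trmxK UT mulmxA.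
- by rewrite XA !trmx_mul trmxK VT mulmxA.
Qed.

Lemma penrose_uniq m n (A : 'M[R]_(m, n)) X Y :
  penrose A X -> penrose A Y -> X = Y.
Proof.
move=> [X1 X2 X3 X4] [Y1 Y2 Y3 Y4].
have e1 : A *m X = A *m Y.
  rewrite -X3 -{1}Y1 -(mulmxA (A *m Y)) trmx_mul X3 Y3.
  by rewrite mulmxA X1.
have e2 : X *m A = Y *m A.
  rewrite -X4 -{1}Y1 -(mulmxA A) mulmxA trmx_mul X4 Y4.
  by rewrite -mulmxA (mulmxA A) X1.
by rewrite -X2 -mulmxA e1 mulmxA e2.
Qed.

Lemma penrose_mpinv m n (A : 'M[R]_(m, n)) : penrose A (mpinv A).
Proof.
have [X pX] := penrose_ex A.
exact: (@xgetPex _ 0 [set X | penrose A X] (ex_intro _ X pX)).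
Qed.

Lemma is_orthproj_null m n (A : 'M[R]_(m, n)) v :
  is_orthproj (mxnull A) v (v - mpinv A *m A *m v).
Proof.
have [p1 p2 p3 p4] := penrose_mpinv A; split=> [|z Az].
  by rewrite /mxnull /= mulmxBr !mulmxA p1 subrr.
by rewrite opprB addrC subrK trmx_mul p4 -!mulmxA Az !mulmx0.
Qed.

Lemma is_orthproj_null_uniq m n (A : 'M[R]_(m, n)) v p q :
  is_orthproj (mxnull A) v p -> is_orthproj (mxnull A) v q -> p = q.
Proof.
move=> [Ap vp] [Aq vq]; apply/eqP; rewrite -subr_eq0; apply/eqP/mulTmx_eq0.
have Apq : mxnull A (p - q) by rewrite /mxnull /= mulmxBr Ap Aq subrr.
have -> : (p - q)^T = (v - q)^T - (v - p)^T.
  by rewrite -linearB /=; congr trmx; rewrite opprB [RHS]addrC addrA subrK.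
by rewrite mulmxBl vp // vq // subrr.
Qed.

Lemma orthproj_nullP m n (A : 'M[R]_(m, n)) v :
  is_orthproj (mxnull A) v (orthproj (mxnull A) v).
Proof.
exact: (@xgetPex _ 0 [set p | _] (ex_intro _ _ (is_orthproj_null A v))).
Qed.

Lemma eigenvalue_gram_ge0 m n (A : 'M[R]_(m, n)) a :
  eigenvalue (A^T *m A) a -> 0 <= a.
Proof.
move=> /eigenvalueP [v vA v0].
have sq_ge0 k (w : 'rV[R]_k) : 0 <= (w *m w^T) 0 0.
  by rewrite mxE sumr_ge0 // => i _; rewrite mxE -expr2 sqr_ge0.
have v2 := sq_ge0 _ v.
have v2n : (v *m v^T) 0 0 != 0.
  apply: contraNneq v0 => h; rewrite -trmx_eq0; apply/eqP/mulTmx_eq0.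
  by rewrite trmxK; apply/matrixP => i j; rewrite !ord1 h mxE.
have : ((v *m A^T) *m (v *m A^T)^T) 0 0 = a * (v *m v^T) 0 0.
  by rewrite trmx_mul trmxK mulmxA -(mulmxA v) vA -scalemxAl mxE.
have := sq_ge0 _ (v *m A^T).
by move=> + e; rewrite e pmulr_lge0 // lt_def v2n.
Qed.

Import complex.

Lemma sym_eigenvalue_ex n (S : 'M[R]_n) :
  S^T = S -> S != 0 -> exists2 a, a != 0 & eigenvalue S a.
Proof.
move=> ST S0; pose C := (R[i])%C; pose f : {rmorphism R -> C} := real_complex R.
pose SC : 'M[C]_n := map_mx f S.
have herm : SC \is hermsymmx.
  apply: realsym_hermsym.
    apply/is_hermitianmxP; rewrite expr0 scale1r map_mx_id //.
    by rewrite /SC map_trmx ST.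
  by apply/mxOverP => i j; rewrite mxE complex_real.
have dreal := hermitian_spectral_diag_real herm.
have /orthomx_spectralP SE := hermitian_normalmx herm.
have SC0 : SC != 0 by rewrite map_mx_eq0.
have [i di] : exists i, spectral_diag SC 0 i != 0.
  apply/existsP; rewrite -[X in is_true X]negbK negb_exists.
  apply: contra SC0 => /forallP h; rewrite SE.
  have -> : spectral_diag SC = 0.
    by apply/rowP => j; rewrite mxE; apply/eqP; have := h j; rewrite negbK.
  by rewrite linear0 mulmx0 mul0mx.
have /mxOverP /(_ 0 i) dr := dreal.
have : exists a, spectral_diag SC 0 i = f a.
  by exists (Re (spectral_diag SC 0 i)); rewrite /f /= RRe_real.
case=> a ea; exists a.
  by apply: contra di => /eqP a0; rewrite ea a0 rmorph0.
rewrite eigenvalue_root_char -(fmorph_root f) map_char_poly.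
rewrite -eigenvalue_root_char -/SC -ea.
apply/eigenvalueP; exists (row i (spectralmx SC)).
  rewrite {2}SE -row_mul !mulmxA mulmxV ?spectral_unit // mul1mx.
  by rewrite row_mul row_diag_mx -scalemxAl -rowE.
apply/eqP => r0.
have /(row_freeP) [B eB] : row_free (spectralmx SC).
  by rewrite row_free_unit spectral_unit.
have /rowP /(_ i) : row i (spectralmx SC) *m B = 0 by rewrite r0 mul0mx.
by rewrite -row_mul eB !mxE eqxx => /eqP; rewrite oner_eq0.
Qed.

Lemma poly_roots_seq (p : {poly R}) : p != 0 ->
  exists rs : seq R, forall a, root p a -> a \in rs.
Proof.
elim: {p}(size p) {-2}p (leqnn (size p)) => [|k IH] p sp p0.
  by rewrite leqn0 size_poly_eq0 (negPf p0) in sp.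
have [[a /factor_theorem [q pq]]|h] := pselect (exists a, root p a); last first.
  by exists [::] => a pa; case: h; exists a.
have q0 : q != 0 by apply: contra p0 => /eqP q0; rewrite pq q0 mul0r.
have [|//|rs hrs] := IH q.
  by move: sp; rewrite pq size_Mmonic ?monicXsubC // size_XsubC addn2.
exists (a :: rs) => b; rewrite pq rootM root_XsubC inE => /orP[/hrs ->|->//].
by rewrite orbT.
Qed.

Lemma sigma_minP m n (A : 'M[R]_(m, n)) : A != 0 ->
  is_min [set t | singular_value A t /\ t != 0] (sigma_min A).
Proof.
move=> A0; set P := [set t | _].
suff [s sP] : exists s, is_min P s.
  exact: (@xgetPex _ 0 [set s | is_min P s] (ex_intro _ s sP)).
have S0 : A^T *m A != 0 by apply: contra A0 => /eqP /mulTmx_eq0 ->.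
have [|a a0 ea] := @sym_eigenvalue_ex _ (A^T *m A) _ S0.
  by rewrite trmx_mul trmxK.
have age0 := eigenvalue_gram_ge0 ea.
have Pa : P (Num.sqrt a).
  split; last by rewrite sqrtr_eq0 -ltNge lt_def a0.
  by split; rewrite ?sqrtr_ge0 // sqr_sqrtr.
have [rs hrs] := poly_roots_seq (monic_neq0 (char_poly_monic (A^T *m A))).
pose l := [seq x <- [seq Num.sqrt x | x <- rs] | `[< P x >]].
have Pl s : P s -> s \in l.
  move=> Ps; rewrite mem_filter; apply/andP; split; first exact/asboolP.
  have [[s0 es] _] := Ps; apply/mapP; exists (s ^+ 2).
    by apply: hrs; rewrite -eigenvalue_root_char.
  by rewrite sqrtr_sqr ger0_norm.
have lP s : s \in l -> P s by rewrite mem_filter => /andP[/asboolP].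
pose s := \big[Order.min/Num.sqrt a]_(x <- l) x.
exists s; split; last by move=> t /Pl tl; exact: ge_bigmin_seq.
rewrite /s big_seq; elim/big_ind: _ => //.
by move=> x y; rewrite /Order.min; case: ifP.
Qed.

End Facts.

(* Main.v *)
Require Import Defs.
From mathcomp Require Import all_boot all_order all_algebra.
From mathcomp Require Import boolp classical_sets reals.

(** For a consistent pair (A, b) one has A x_LS = b, so A and b cancel in
    E x_LS - eps, which is just A' x_LS - b'.  The radius therefore depends on
    (A, b) only through x_LS, and minimizing it means minimizing the residual
    of the perturbed system over the achievable centers ([radius_consistent]).
    The residual of x'_LS = A'^+ b' is orthogonal to range A', so Pythagoras
    ([residual_pythagoras]) bounds every other residual below by it, with
    equality exactly when x - x'_LS lies in null A'.

    A center x also satisfies x0 - x \in range A'^T.  Since x'_LS is itself in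
    range A'^T = (null A')^perp, an optimal x makes x - x'_LS a vector of
    null A' that differs from x0 by a vector orthogonal to null A': it is the
    orthogonal projection of x0 onto null A', which gives uniqueness
    ([orthproj_null_charac]).  Conversely x'_LS + x0^n satisfies the range
    condition, and every vector is the least-squares solution of some
    consistent system of rank at most one ([xLS_surj]), so this center is
    attained. *)

Set Implicit Arguments.
Unset Strict Implicit.
Unset Printing Implicit Defensive.

Import Order.TTheory GRing.Theory Num.Theory.

Local Open Scope classical_set_scope.
Local Open Scope ring_scope.

Section EuclideanNorm.
Variable R : realType.

Lemma sqr_enorm n (v : 'cV[R]_n) : enorm v ^+ 2 = (v^T *m v) 0 0.
Proof.
rewrite /enorm sqr_sqrtr; last by apply: sumr_ge0 => i _; rewrite sqr_ge0.
by rewrite mxE; apply: eq_bigr => i _; rewrite mxE expr2.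
Qed.

Lemma enorm_ge0 n (v : 'cV[R]_n) : 0 <= enorm v.
Proof. exact: sqrtr_ge0. Qed.

Lemma enorm0_eq0 n (v : 'cV[R]_n) : enorm v = 0 -> v = 0.
Proof.
move=> v0; apply: mulTmx_eq0; apply/matrixP => i j.
by rewrite !ord1 -sqr_enorm v0 expr0n mxE.
Qed.

Lemma sqr_enormD_orth n (u v : 'cV[R]_n) :
  u^T *m v = 0 -> enorm (u + v) ^+ 2 = enorm u ^+ 2 + enorm v ^+ 2.
Proof.
move=> uv0; have vu0 : v^T *m u = 0.
  by apply: trmx_inj; rewrite trmx_mul trmxK uv0 trmx0.
rewrite !sqr_enorm [(u + v)^T]linearD /= mulmxDl !mulmxDr uv0 vu0 addr0 add0r.
by rewrite mxE.
Qed.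

End EuclideanNorm.

Section LeastSquares.
Variable R : realType.
Implicit Types m n : nat.

(** The normal equations: A A^+ is symmetric, so
    A^T A A^+ = (A A^+ A)^T = A^T. *)
Lemma normal_equations m n (A : 'M[R]_(m, n)) b :
  A^T *m (A *m xLS A b - b) = 0.
Proof.
have [p1 _ p3 _] := penrose_mpinv A.
by rewrite mulmxBr mulmxA /xLS !mulmxA -(mulmxA A^T) -p3 -trmx_mul p1 subrr.
Qed.

Lemma residual_pythagoras m n (A : 'M[R]_(m, n)) b x :
  enorm (A *m x - b) ^+ 2 =
  enorm (A *m (x - xLS A b)) ^+ 2 + enorm (A *m xLS A b - b) ^+ 2.
Proof.
rewrite -sqr_enormD_orth; first by rewrite mulmxBr addrA subrK.
by rewrite trmx_mul -mulmxA normal_equations mulmx0.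
Qed.

Lemma residual_xLS_le m n (A : 'M[R]_(m, n)) b x :
  enorm (A *m xLS A b - b) <= enorm (A *m x - b).
Proof.
rewrite -ler_sqr ?nnegrE ?enorm_ge0 // (residual_pythagoras A b x).
by rewrite lerDr sqr_ge0.
Qed.

Lemma residual_xLS_eq m n (A : 'M[R]_(m, n)) b x :
  enorm (A *m x - b) = enorm (A *m xLS A b - b) -> A *m (x - xLS A b) = 0.
Proof.
move=> e; apply/enorm0_eq0/eqP; rewrite -sqrf_eq0.
by rewrite -(inj_eq (addIr (enorm (A *m xLS A b - b) ^+ 2)))
  -residual_pythagoras e add0r.
Qed.

Lemma mulmx_xLS_consistent m n (A : 'M[R]_(m, n)) b :
  consistent A b -> A *m xLS A b = b.
Proof.
by have [p1 _ _ _] := penrose_mpinv A; case=> x <-; rewrite /xLS !mulmxA p1.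
Qed.

(** A^+ A is the orthogonal projector onto range A^T: being symmetric, it
    equals A^T (A^+)^T. *)
Lemma mpinv_mul_range m n (A : 'M[R]_(m, n)) v :
  mxrange A^T (mpinv A *m A *m v).
Proof.
have [_ _ _ p4] := penrose_mpinv A.
by exists ((mpinv A)^T *m v) => //; rewrite mulmxA -trmx_mul p4.
Qed.

Lemma xLS_range m n (A : 'M[R]_(m, n)) b : mxrange A^T (xLS A b).
Proof.
have [_ p2 _ _] := penrose_mpinv A.
by rewrite /xLS -[X in mxrange _ (X *m b)]p2 -mulmxA; apply: mpinv_mul_range.
Qed.

Lemma xLS_mulmx_range m n (A : 'M[R]_(m, n)) x :
  mxrange A^T x -> xLS A (A *m x) = x.
Proof.
have [p1 _ _ p4] := penrose_mpinv A; case=> w _ <-.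
by rewrite /xLS !mulmxA -p4 -trmx_mul mulmxA p1.
Qed.

(** The rank-at-most-one matrix A = e x^T, with e a unit vector, satisfies
    x = A^T e; hence x is the minimum-norm solution of A y = A x. *)
Lemma xLS_surj m n (i : 'I_m) (x : 'cV[R]_n) :
  exists A : 'M[R]_(m, n), xLS A (A *m x) = x.
Proof.
pose e : 'cV[R]_m := delta_mx i 0.
exists (e *m x^T); apply: xLS_mulmx_range; exists e => //.
rewrite trmx_mul trmxK -mulmxA /e trmx_delta mul_delta_mx.
by rewrite [delta_mx 0 0]mx11_scalar mxE !eqxx mulmx1.
Qed.

Lemma mxrangeD m n (A : 'M[R]_(m, n)) u v :
  mxrange A u -> mxrange A v -> mxrange A (u + v).
Proof. by case=> x _ <- [y _ <-]; exists (x + y) => //; rewrite mulmxDr. Qed.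

Lemma mxrangeN m n (A : 'M[R]_(m, n)) u : mxrange A u -> mxrange A (- u).
Proof. by case=> x _ <-; exists (- x) => //; rewrite mulmxN. Qed.

(** Every vector A^T w is orthogonal to null A, since (A^T w)^T z = w^T (A z);
    so p has the defining properties of the projection. *)
Lemma orthproj_null_charac m n (A : 'M[R]_(m, n)) v p :
  A *m p = 0 -> mxrange A^T (v - p) -> orthproj (mxnull A) v = p.
Proof.
move=> Ap [w _ vp]; apply: is_orthproj_null_uniq (orthproj_nullP A v) _.
by split=> // z Az; rewrite -vp trmx_mul trmxK -mulmxA Az mulmx0.
Qed.

Lemma sub_orthproj_null_range m n (A : 'M[R]_(m, n)) v :
  mxrange A^T (v - orthproj (mxnull A) v).
Proof.
rewrite (is_orthproj_null_uniq (orthproj_nullP A v) (is_orthproj_null A v)).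
by rewrite subKr; apply: mpinv_mul_range.
Qed.

Lemma sigma_min_gt0 m n (A : 'M[R]_(m, n)) : A != 0 -> 0 < sigma_min A.
Proof.
by move=> /sigma_minP[[[s0 _] sn0] _]; rewrite lt_def sn0 s0.
Qed.

Lemma radius_consistent m n (A' : 'M[R]_(m, n)) b' A b : consistent A b ->
  radius A' b' A b = enorm (A' *m xLS A b - b') / sigma_min A'.
Proof.
move=> /mulmx_xLS_consistent Ab; rewrite /radius; congr (enorm _ / _).
by rewrite mulmxBl Ab opprB addrA subrK.
Qed.

End LeastSquares.

Theorem corollary3 (R : realType) (m n : nat) (A' : 'M[R]_(m, n))
    (b' : 'cV[R]_m) (x0 : 'cV[R]_n) (A'_neq0 : A' != 0) :
  let rmin := enorm (A' *m xLS A' b' - b') / sigma_min A' in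
  is_min [set radius A' b' Ab.1 Ab.2 | Ab in Kset A' x0] rmin /\
  (forall (A : 'M[R]_(m, n)) (b : 'cV[R]_m),
     Kset A' x0 (A, b) -> radius A' b' A b = rmin ->
     xLS A b = xLS A' b' + orthproj (mxnull A') x0).
Proof.
move=> rmin; have s0 := sigma_min_gt0 A'_neq0.
split; [split|].
- pose p := orthproj (mxnull A') x0.
  have Ap : A' *m p = 0 by have [] := orthproj_nullP A' x0.
  (* A nonzero matrix has a row, from which the rank-one system is built. *)
  have [i _] : exists i, row i A' != 0.
    apply/existsP; apply: contraNT A'_neq0; rewrite negb_exists => /forallP h.
    apply/eqP/row_matrixP => i; rewrite row0; apply/eqP.
    by have := h i; rewrite negbK.
  have [A xA] := xLS_surj i (xLS A' b' + p).
  have cA : consistent A (A *m (xLS A' b' + p)) by exists (xLS A' b' + p).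
  exists (A, A *m (xLS A' b' + p)) => /=.
    split=> //=; rewrite xA opprD addrA addrAC.
    apply: mxrangeD; first exact: sub_orthproj_null_range.
    exact/mxrangeN/xLS_range.
  by rewrite radius_consistent // xA mulmxDr Ap addr0.
- move=> _ [[A b] [/= cA _] <-]; rewrite radius_consistent //.
  by rewrite ler_pM2r ?invr_gt0 //; apply: residual_xLS_le.
- move=> A b [/= cA rA]; rewrite radius_consistent // => /divIf e.
  have /residual_xLS_eq Ax := e (lt0r_neq0 s0).
  rewrite (orthproj_null_charac Ax); first by rewrite addrC subrK.
  by rewrite opprB addrCA addrC; apply: mxrangeD => //; apply: xLS_range.
Qed.
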